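(* For every positive integer $n$: (i) $\mathrm{Comp}_{n+1}(S_n) = S_{n+1}$; (ii) if $n\ge 2$, then $\mathrm{Comp}_{n+1}(\{\iota_n\}) = \{\iota_{n+1}\}$; (iii) if $n \ge 3$, then $\mathrm{Comp}_{n+1}(\langle\delta_n\rangle) = \langle \delta_{n+1}\rangle$.
   Context: $S_n$ is the symmetric group on $[n]=\{1,\dots,n\}$; $\iota_n$ is the identity and $\delta_n$ the descending permutation $i\mapsto n+1-i$. A permutation $\pi\in S_m$ involves $\tau\in S_n$ ($n\le m$) if there are indices $i_1<\dots<i_n$ with $\pi(i_j)<\pi(i_k)$ iff $\tau(j)<\tau(k)$ for all $j,k$; such $\tau$ is an $n$-pattern of $\pi$. For $S\subseteq S_n$, $\mathrm{Comp}_m(S)$ is the set of all $\tau\in S_m$ all of whose $n$-patterns belong to $S$. *)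

(* Defs.v *)
From mathcomp Require Import all_boot all_fingroup.

Set Implicit Arguments.
Unset Strict Implicit.
Unset Printing Implicit Defensive.

(* [n] is encoded as 'I_n = {0, ..., n-1}; the identity of 'S_n is 1%g.
   Under the shift by one, i |-> n+1-i becomes i |-> n-1-i, i.e. rev_ord. *)
Definition desc_perm (n : nat) : 'S_n := perm (@rev_ord_inj n).

(* f lists the indices i_1 < ... < i_n; 'I_m and 'I_n are compared as nat. *)
Definition involves (m n : nat) (p : 'S_m) (t : 'S_n) : bool :=
  [exists f : {ffun 'I_n -> 'I_m},
     [forall j : 'I_n, forall k : 'I_n, (j < k) ==> (f j < f k)] &&
     [forall j : 'I_n, forall k : 'I_n, (p (f j) < p (f k)) == (t j < t k)]].

Definition Comp (m n : nat) (S : {set 'S_n}) : {set 'S_m} :=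
  [set p : 'S_m | [forall t : 'S_n, involves p t ==> (t \in S)]].
Arguments Comp m {n} S.

(* Main.v *)
(* Deleting one entry of a permutation of [n+1] leaves an n-pattern, so
   membership in Comp constrains the relative order of any set of entries that
   misses at least one position.  For {1} it suffices to look at pairs; for
   {1, delta} at triples a < b < c, on which the permutation must be monotone,
   so that all pairs are compared the same way as the first two positions. *)
Require Import Defs.
From mathcomp Require Import all_boot all_fingroup.
From mathcomp Require Import zify.

Set Implicit Arguments.
Unset Strict Implicit.
Unset Printing Implicit Defensive.

Lemma involvesP m n (p : 'S_m) (t : 'S_n) :
  reflect (exists2 f : 'I_n -> 'I_m,
             forall j k : 'I_n, j < k -> f j < f k
           & forall j k : 'I_n, (p (f j) < p (f k)) = (t j < t k))
          (involves p t).
Proof.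
apply: (iffP existsP) => [[f /andP[/'forall_forallP fi /'forall_forallP fo]]|].
  by exists f => j k; [move/implyP: (fi j k) | move/eqP: (fo j k)].
case=> f fi fo; exists (finfun f); apply/andP; split.
  by apply/'forall_forallP => j k; rewrite !ffunE; apply/implyP/fi.
by apply/'forall_forallP => j k; rewrite !ffunE fo.
Qed.

Lemma ltn_lift n (h : 'I_n.+1) (j k : 'I_n) : (lift h j < lift h k) = (j < k).
Proof. by rewrite !ltnNge /= leq_bump2. Qed.

(** Away from [h], [p] never takes the value [p h], so each value there is [lift (p h)] of a unique
    index; these indices form [t], and [lift] preserves order. *)
Lemma delete_pattern n (p : 'S_n.+1) (h : 'I_n.+1) :
  exists t : 'S_n,
    forall j k : 'I_n, (p (lift h j) < p (lift h k)) = (t j < t k).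
Proof.
have /fin_all_exists[g gE] (j : 'I_n) : exists i, p (lift h j) = lift (p h) i.
  have /unlift_some[i -> _]: p h != p (lift h j); last by exists i.
  by rewrite (inj_eq perm_inj) neq_lift.
have g_inj : injective g.
  by move=> j k eq_g; apply/(@lift_inj _ h)/(@perm_inj _ p); rewrite !gE eq_g.
by exists (perm g_inj) => j k; rewrite !permE !gE ltn_lift.
Qed.

Lemma Comp_delete n (S : {set 'S_n}) (p : 'S_n.+1) (h : 'I_n.+1) :
  p \in Comp n.+1 S ->
  exists2 t : 'S_n, t \in S &
    forall j k : 'I_n, (p (lift h j) < p (lift h k)) = (t j < t k).
Proof.
rewrite inE => /forallP pS; have [t tE] := delete_pattern p h; exists t => //.
apply: (implyP (pS t)); apply/involvesP; exists (lift h) => // j k.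
by rewrite ltn_lift.
Qed.

(** An increasing permutation satisfies [j <= t j] by induction on [j]; its inverse is increasing
    too, which gives the opposite inequality. *)
Lemma increasing_perm_eq1 n (t : 'S_n) :
  (forall j k : 'I_n, j < k -> t j < t k) -> t = 1%g.
Proof.
have le_incr (s : 'S_n) : (forall j k : 'I_n, j < k -> s j < s k) ->
    forall j : 'I_n, j <= s j.
  move=> s_inc [j /= ltjn]; elim: j ltjn => // j IHj ltjn.
  by apply: leq_ltn_trans (IHj (ltnW ltjn)) _; apply: s_inc => /=.
move=> t_inc; apply/permP=> j; rewrite perm1; apply/val_inj/eqP => /=.
(* Writing the right-hand [j] as the inverse image of [t j] turns [t j <= j] into the same bound for
   the inverse of [t]. *)
rewrite eqn_leq le_incr // andbT -{2}(permK t j); apply: le_incr => i k.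
rewrite -{1}(permKV t i) -{1}(permKV t k).
case: (ltngtP (t^-1%g i) (t^-1%g k)) => // [/t_inc|/val_inj->]; lia.
Qed.

Lemma desc_permE n (j : 'I_n) : desc_perm n j = rev_ord j.
Proof. by rewrite permE. Qed.

Lemma desc_perm_mul n : (desc_perm n * desc_perm n = 1)%g.
Proof. by apply/permP=> j; rewrite permM !desc_permE rev_ordK perm1. Qed.

Lemma ltn_desc n (j k : 'I_n) : (desc_perm n j < desc_perm n k) = (k < j).
Proof. by rewrite !desc_permE /=; have := ltn_ord j; have := ltn_ord k; lia. Qed.

(** Composing with the order-reversing involution [desc_perm n] reduces this to the increasing
    case. *)
Lemma decreasing_perm_eq_desc n (t : 'S_n) :
  (forall j k : 'I_n, j < k -> t k < t j) -> t = desc_perm n.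
Proof.
move=> t_dec; have t_desc : (t * desc_perm n)%g = 1%g.
  by apply: increasing_perm_eq1 => j k /t_dec; rewrite !permM ltn_desc.
by rewrite -[t]mulg1 -(desc_perm_mul n) mulgA t_desc mul1g.
Qed.

Lemma mem_cycle_desc n (t : 'S_n) :
  (t \in <[desc_perm n]>%g) = (t == 1%g) || (t == desc_perm n).
Proof.
apply/idP/idP => [/cycleP[k ->]|/orP[]/eqP->]; last 2 first.
- exact: group1.
- exact: cycle_id.
elim: k => [|k /orP[]/eqP IHk]; first by rewrite expg0 eqxx.
  by rewrite expgS IHk mulg1 eqxx orbT.
by rewrite expgS IHk desc_perm_mul eqxx.
Qed.

(** Patterns of a monotone permutation are monotone in the same direction; with [involves_desc] this
    yields the easy inclusions. *)
Lemma involves1 m n (t : 'S_n) : involves (1%g : 'S_m) t -> t = 1%g.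
Proof.
case/involvesP=> f f_inc fE; apply: increasing_perm_eq1 => j k /f_inc.
by rewrite -fE !perm1.
Qed.

Lemma involves_desc m n (t : 'S_n) :
  involves (desc_perm m) t -> t = desc_perm n.
Proof.
case/involvesP=> f f_inc fE; apply: decreasing_perm_eq_desc => j k /f_inc.
by rewrite -fE ltn_desc.
Qed.

(** Supplies a position to delete that spares the entries under comparison. *)
Lemma exists_notin_ord n (s : seq 'I_n) :
  size s < n -> exists h : 'I_n, h \notin s.
Proof.
move=> lt_s; apply/existsP; rewrite -negb_forall; apply/forallP => sT.
have /subset_leq_card : 'I_n \subset s by apply/subsetP=> h _; apply: sT.
by rewrite card_ord leqNgt (leq_ltn_trans (card_size s)).
Qed.

Lemma Comp1_increasing n (p : 'S_n.+1) : 2 <= n ->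
  p \in Comp n.+1 [set (1%g : 'S_n)] ->
  forall a b : 'I_n.+1, a < b -> p a < p b.
Proof.
move=> n_ge2 pC a b.
have [//|h] := @exists_notin_ord n.+1 [:: a; b].
rewrite !inE negb_or => /andP[/unlift_some[a' -> _] /unlift_some[b' -> _]].
have [t /set1P-> tE] := Comp_delete h pC.
by rewrite tE !perm1 ltn_lift.
Qed.

Lemma Comp_desc_triple n (p : 'S_n.+1) : 3 <= n ->
  p \in Comp n.+1 <[desc_perm n]>%g ->
  forall a b c : 'I_n.+1, a < b -> b < c ->
  (p a < p b) = (p b < p c) /\ (p a < p c) = (p b < p c).
Proof.
move=> n_ge3 pC a b c.
(* This is where [3 <= n] matters: at least four positions are needed to leave one outside the
   triple. *)
have [//|h] := @exists_notin_ord n.+1 [:: a; b; c].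
rewrite !inE !negb_or => /and3P[].
move=> /unlift_some[a' -> _] /unlift_some[b' -> _] /unlift_some[c' -> _].
have [t + tE] := Comp_delete h pC.
by rewrite !tE !ltn_lift mem_cycle_desc => /orP[]/eqP->;
  rewrite ?perm1 ?ltn_desc; lia.
Qed.

(** The pair [(a, b)] is linked to [(0, b)] by the triple [0 < a < b], and [(0, b)] to [(0, 1)] by
    the triple [0 < 1 < b]; the cases [a = 0] and [b = 1] are degenerate. *)
Lemma Comp_desc_constant n (p : 'S_n.+1) : 3 <= n ->
  p \in Comp n.+1 <[desc_perm n]>%g ->
  forall a b : 'I_n.+1, a < b -> (p a < p b) = (p ord0 < p (inord 1)).
Proof.
move=> n_ge3 pC a b lt_ab; have triple := Comp_desc_triple n_ge3 pC.
(* [inord] falls back to a default out of range, so [1 < n.+1] has to be checked. *)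
have val1 : @inord n 1 = 1 :> nat by rewrite inordK; lia.
have from0 (c : 'I_n.+1) : 0 < c -> (p ord0 < p c) = (p ord0 < p (inord 1)).
  rewrite leq_eqVlt => /predU1P[c1|c_gt1].
    by congr (_ < val (p _)); apply: val_inj; rewrite /= val1.
  by have [||-> ->] := triple ord0 (inord 1) c; rewrite ?val1.
have [a0|a_gt0] := posnP a.
  by rewrite -(from0 b) -?a0 //; congr (val (p _) < _); apply: val_inj.
by have [//|//|_ <-] := triple ord0 a b; rewrite from0 //; lia.
Qed.

Theorem theorem4p3 (n : nat) (n_gt0 : 0 < n) :
  [/\ Comp n.+1 [set: 'S_n] = [set: 'S_n.+1],
      2 <= n -> Comp n.+1 [set (1%g : 'S_n)] = [set (1%g : 'S_n.+1)]
    & 3 <= n -> Comp n.+1 <[desc_perm n]>%g = <[desc_perm n.+1]>%g].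
Proof.
split=> [|n_ge2|n_ge3]; apply/setP=> p.
- by rewrite !inE; apply/forallP => t; rewrite inE implybT.
- apply/idP/set1P => [pC|->]; first exact/increasing_perm_eq1/Comp1_increasing.
  by rewrite inE; apply/forallP => t; apply/implyP=> /involves1->; rewrite inE.
rewrite mem_cycle_desc; apply/idP/orP => [pC|[]/eqP->]; last 2 first.
- rewrite inE; apply/forallP => t; apply/implyP=> /involves1->.
  exact: group1.
- rewrite inE; apply/forallP => t; apply/implyP=> /involves_desc->.
  exact: cycle_id.
have p_const := Comp_desc_constant n_ge3 pC.
have [p01|p10] := boolP (p ord0 < p (inord 1)).
  by left; apply/eqP/increasing_perm_eq1 => a b /p_const->.
right; apply/eqP/decreasing_perm_eq_desc => a b lt_ab.
(* Failure of [p a < p b] only gives [p b <= p a]; injectivity of [p] excludes equality. *)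
have := p_const _ _ lt_ab; rewrite (negPf p10) ltnNge => /negbFE.
rewrite leq_eqVlt => /predU1P[/val_inj/perm_inj eq_ba|//].
by rewrite eq_ba ltnn in lt_ab.
Qed.
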